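(* Let $q$ be an odd prime power and let $\gamma,\delta\in\mathbb{F}_{q^2}$ with $\gamma\neq 0$. Then the polynomial $$f(x)=(x^q-x+\delta)^{q+4}+(x^q-x+\delta)^{5}+\gamma x$$ is a permutation polynomial of $\mathbb{F}_{q^2}$ if and only if one of the following holds: (i) $\mathrm{Tr}_q^{q^2}(\delta)=0$; (ii) $\mathrm{Tr}_q^{q^2}(\delta)\neq0$, $\gamma\in\mathbb{F}_q^*$, $3\mid q$ and $\mathrm{Tr}_q^{q^2}(\gamma)/2-\left(\mathrm{Tr}_q^{q^2}(\delta)\right)^4$ is a square in $\mathbb{F}_q$; (iii) $\mathrm{Tr}_q^{q^2}(\delta)\neq0$, $\gamma\in\mathbb{F}_q^*$, $q\equiv 2\pmod 3$ and $2\left(\mathrm{Tr}_q^{q^2}(\delta)\right)^4=\mathrm{Tr}_q^{q^2}(\gamma)$.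
   Context: A polynomial over a finite field $\mathbb{F}$ is a permutation polynomial of $\mathbb{F}$ if the map it induces on $\mathbb{F}$ is a bijection. For $x\in\mathbb{F}_{q^2}$, $\mathrm{Tr}_q^{q^2}(x)=x+x^q$. *)

(* Defs.v *)
From HB Require Import structures.
From mathcomp Require Import all_boot all_order all_algebra all_field.

Set Implicit Arguments.
Unset Strict Implicit.
Unset Printing Implicit Defensive.

Import GRing.Theory.
Local Open Scope ring_scope.

Definition perm_poly_on (F : finFieldType) (f : {poly F}) : Prop :=
  bijective (fun x : F => f.[x]).

Definition Tr_quad (F : finFieldType) (q : nat) (x : F) : F := x + x ^+ q.

(* The subfield F_q of F_(q^2) is given as the image of a field embedding
   iota : K -> L; 0 counts as a square. *)
Definition square_in_subfield (K L : finFieldType) (iota : {rmorphism K -> L})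
    (x : L) : Prop :=
  exists c : K, x = iota (c ^+ 2).

Definition f_poly (F : finFieldType) (q : nat) (gamma delta : F) : {poly F} :=
  ('X^q - 'X + delta%:P) ^+ (q + 4) + ('X^q - 'X + delta%:P) ^+ 5
    + gamma%:P * 'X.

(* Main.v *)
Require Import Defs.
From HB Require Import structures.
From mathcomp Require Import all_boot all_order all_algebra all_field.
From mathcomp Require Import fingroup pgroup cyclic ring zify.

Set Implicit Arguments.
Unset Strict Implicit.
Unset Printing Implicit Defensive.

Import GRing.Theory.
Local Open Scope ring_scope.

(* Put s = x^q - x + delta and T = Tr delta. Then s^q + s = T, so that
   f(x) = T s^4 + gamma x, and only T != 0 needs work. Choose eps with
   eps^q = - eps; then eps^2 = n is a nonsquare of K, and in the coordinates
   u + v eps the map f becomes a polynomial map of the plane K^2. If gamma lies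
   in K, bijectivity reduces to that of a cubic y^3 + c y on K; otherwise,
   eliminating u, it implies that of a quartic z^4 + c z^2 + k z with c = 0
   exactly in characteristic 3, which is impossible. Away from characteristic 3,
   both are handled by Hermite's criterion; in characteristic 3 the cubic is
   additive, and the quartic vanishes at 0 and at the cube root of - k. *)

(** * Squares and power sums in a finite field *)

Lemma finField_card_gt1 (F : finFieldType) : (1 < #|F|)%N.
Proof. exact: finNzRing_gt1. Qed.

Lemma expf_card_pred (F : finFieldType) (x : F) : x != 0 -> x ^+ #|F|.-1 = 1.
Proof.
move=> x0; apply: (mulfI x0).
by rewrite -exprS prednK ?expf_card ?mulr1 // (ltnW (finField_card_gt1 F)).
Qed.

Lemma finField_prim_root (F : finFieldType) :
  exists z : F, (#|F|.-1).-primitive_root z.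
Proof.
have F_gt1 := finField_card_gt1 F.
have /hasP[z _ z_prim] : has (#|F|.-1).-primitive_root (enum (predC1 (0 : F))).
  apply: has_prim_root; rewrite ?enum_uniq //.
  - by rewrite -ltnS prednK // ltnW.
  - apply/allP=> x; rewrite mem_enum /= => x0.
    by rewrite unity_rootE expf_card_pred.
  - by rewrite -cardE cardC1.
by exists z.
Qed.

Lemma finField_prim_exp (F : finFieldType) (z x : F) :
  (#|F|.-1).-primitive_root z -> x != 0 -> exists i, x = z ^+ i.
Proof.
move=> z_prim x0.
have [i ->] := prim_rootP z_prim (expf_card_pred x0).
by exists i.
Qed.

(** A nonsquare is an odd power of a primitive root, and two odd exponents have an even sum. *)
Lemma finField_nonsquareM (F : finFieldType) (x y : F) :
  (forall c, x != c ^+ 2) -> (forall c, y != c ^+ 2) ->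
  exists c, x * y = c ^+ 2.
Proof.
move=> xNsq yNsq; have [z z_prim] := finField_prim_root F.
have odd_log w : (forall c, w != c ^+ 2) -> exists i, w = z ^+ (i.*2).+1.
  move=> wNsq; have w0 : w != 0 by rewrite (eq_rect _ (fun a => w != a) (wNsq 0)) ?expr0n.
  have [i def_w] := finField_prim_exp z_prim w0.
  have := odd_double_half i; case: (odd i) => def_i; first by exists i./2; rewrite def_w -{1}def_i.
  by case/eqP: (wNsq (z ^+ i./2)); rewrite def_w -{1}def_i add0n -mul2n mulnC exprM.
have [[i ->] [j ->]] := (odd_log x xNsq, odd_log y yNsq).
by exists (z ^+ (i + j).+1); rewrite -exprD -exprM; congr (_ ^+ _); lia.
Qed.

(** Translation by 1 permutes F, so adding [#|F|] times 1 leaves the sum of all elements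
    unchanged. *)
Lemma natr_card (F : finFieldType) : #|F|%:R = 0 :> F.
Proof.
apply: (addrI (\sum_(x : F) x)); rewrite addr0 -sumr_const -big_split /=.
by rewrite [RHS](reindex_inj (addIr 1)).
Qed.

Lemma pnat_card_pchar (F : finFieldType) : ([pchar F]).-nat #|F|.
Proof.
have [p p_pr pF] := finPcharP F.
have := pprimeChar_pgroup pF; rewrite /pgroup cardsT.
by apply: sub_in_pnat => r _ /eqP->.
Qed.

(** For k > 0, scaling by a primitive root z multiplies the sum by z ^ k, which is not 1. For k = 0
    every term is 1, also at x = 0, and the sum is [#|F|]. *)
Lemma sum_exp_eq0 (F : finFieldType) k :
  (k < #|F|.-1)%N -> \sum_(x : F) x ^+ k = 0.
Proof.
case: k => [_|k ltk].
  by under eq_bigr do rewrite expr0; rewrite sumr_const natr_card.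
have [z z_prim] := finField_prim_root F.
have z0 : z != 0.
  apply: contraTneq ltk => z0; have := prim_expr_order z_prim.
  by rewrite z0 expr0n; case: (#|F|.-1) => //= n /eqP; rewrite eq_sym oner_eq0.
have : \sum_(x : F) x ^+ k.+1 = z ^+ k.+1 * \sum_(x : F) x ^+ k.+1.
  rewrite [LHS](reindex_inj (mulfI z0)) mulr_sumr.
  by apply: eq_bigr => x _; rewrite exprMn.
move/eqP; rewrite -subr_eq0 -{1}[X in X - _]mul1r -mulrBl mulf_eq0 => /orP[|/eqP//].
rewrite subr_eq0 eq_sym -(prim_order_dvd z_prim) => /dvdn_leq; lia.
Qed.

Lemma sum_exp_card_pred (F : finFieldType) :
  \sum_(x : F) x ^+ #|F|.-1 = -1.
Proof.
have F_gt1 := finField_card_gt1 F.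
have q1_gt0 : (0 < #|F|.-1)%N by rewrite -ltnS prednK // ltnW.
rewrite (bigD1 0) //= expr0n eqn0Ngt q1_gt0 add0r.
rewrite (eq_bigr (fun=> 1)) => [|x x0]; last exact: expf_card_pred.
by rewrite sumr_const cardC1 -subn1 natrB ?(ltnW F_gt1) // natr_card sub0r.
Qed.

Lemma sum_horner_eq0 (F : finFieldType) (p : {poly F}) :
  (size p <= #|F|.-1)%N -> \sum_x p.[x] = 0.
Proof.
move=> szp; under eq_bigr do rewrite horner_coef.
rewrite exchange_big big1 //= => i _.
by rewrite -mulr_sumr sum_exp_eq0 ?mulr0 // (leq_trans (ltn_ord i)).
Qed.

(** * Powers of a depressed polynomial and Hermite's criterion *)

Lemma size_polyD_leq_max (R : nzRingType) (p1 p2 : {poly R}) k :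
  (size p1 <= k)%N -> (size p2 <= k)%N -> (size (p1 + p2)%R <= k)%N.
Proof. by move=> h1 h2; rewrite (leq_trans (size_polyD _ _)) // geq_max h1. Qed.

Lemma size_mul_leq_add (R : nzRingType) (p1 p2 : {poly R}) i j k :
  (size p1 <= i.+1)%N -> (size p2 <= j)%N -> (i + j <= k)%N ->
  (size (p1 * p2)%R <= k)%N.
Proof.
move=> h1 h2 hk; apply: leq_trans (size_polyMleq _ _) _; lia.
Qed.

(** The gap just below the leading term persists in powers, and the coefficient two degrees below
    the top arises by picking [c *: 'X^e] from exactly one of the [m.+1] factors. The exponents are
    written so as to avoid natural subtraction. *)
Lemma expr_depressed (R : comNzRingType) (e m : nat) (c : R) (h : {poly R}) :
  (size h <= e)%N ->
  exists2 h' : {poly R}, (size h' <= e + m * e.+2)%N &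
    ('X^(e.+2) + c *: 'X^e + h) ^+ m.+1 =
    'X^(e.+2 + m * e.+2) + (m.+1%:R * c) *: 'X^(e + m * e.+2) + h'.
Proof.
move=> szh; elim: m => [|m [h' szh' IH]].
  by exists h; rewrite ?mul0n ?addn0 // expr1 mul1r.
rewrite exprSr IH; set E := (e + m * e.+2)%N.
have -> : (e.+2 + m * e.+2 = E.+2)%N by lia.
have -> : (e.+2 + m.+1 * e.+2 = E.+2 + e.+2)%N by lia.
have -> : (e + m.+1 * e.+2 = E.+2 + e)%N by lia.
set c' := m.+1%:R * c.
have szX k a j : (k < j)%N -> (size (a *: 'X^k : {poly R}) <= j)%N.
  by move=> ltkj; rewrite (leq_trans (size_scale_leq _ _)) // size_polyXn.
have szXn k j : (k < j)%N -> (size ('X^k : {poly R}) <= j)%N.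
  by rewrite size_polyXn.
pose g := 'X^(e.+2) + c *: 'X^e + h.
have szg : (size g <= e.+3)%N.
  by apply: size_polyD_leq_max; [apply: size_polyD_leq_max; [apply: szXn|apply: szX]
                           |apply: leq_trans szh _]; lia.
exists ('X^(E.+2) * h + c' *: 'X^E * (c *: 'X^e + h) + h' * g).
  apply: size_polyD_leq_max; first apply: size_polyD_leq_max.
  - by apply: (@size_mul_leq_add _ _ _ E.+2 e); [exact: szXn | exact: szh | lia].
  - apply: (@size_mul_leq_add _ _ _ E e.+1); first exact: szX.
      by apply: size_polyD_leq_max; [exact: szX | exact: leqW].
    lia.
  - by rewrite mulrC; apply: (size_mul_leq_add szg szh'); lia.
have -> : m.+2%:R * c = c + c' by rewrite mulrS mulrDl mul1r.
rewrite /g -!mul_polyC 2!['X^(E.+2 + _)]exprD polyCD !(exprSr _ _.+1) !(exprSr _ E) !(exprSr _ e).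
ring.
Qed.

(* Hermite's criterion: a permutation g makes the power sums of g ^ k vanish for
   k < q - 1. The exponent (q - 1) / d, resp. (q + 1) / d, with d the degree of
   g, leaves in g ^ k only one monomial with a nonzero sum, x ^ (q - 1), of
   coefficient 1, resp. c (q + 1) / d; in the latter case the leading x ^ (q + 1)
   sums like x ^ 2. *)
Lemma hermite_depressed (F : finFieldType) (e : nat) (c : F) (h : {poly F}) :
  (size h <= e)%N -> (3 < #|F|)%N ->
  (e.+2 %| #|F|.-1)%N \/ (e.+2 %| #|F|.+1)%N /\ c != 0 ->
  ~ injective (fun x : F => ('X^(e.+2) + c *: 'X^e + h).[x]).
Proof.
move=> szh q_gt3 dvd_q inj_g; set g := 'X^(e.+2) + _ + _ in inj_g.
have sum_g k : (k < #|F|.-1)%N -> \sum_x (g ^+ k).[x] = 0.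
  move=> ltk; under eq_bigr do rewrite horner_exp.
  by rewrite -[RHS](sum_exp_eq0 ltk) [RHS](reindex_inj inj_g).
case: dvd_q => [/dvdnP[[|m] def_q]|[/dvdnP[[|m] def_q] c0]]; try lia.
  have := sum_g m.+1; have [h' szh' ->] := expr_depressed m c szh.
  rewrite -mulSn -def_q.
  move=> /(_ ltac:(lia)).
  under eq_bigr do rewrite -addrA hornerD hornerXn.
  rewrite big_split /= sum_exp_card_pred sum_horner_eq0 ?addr0.
    by move/eqP; rewrite oppr_eq0 oner_eq0.
  rewrite size_polyD_leq_max //; last by apply: (leq_trans szh'); lia.
  by rewrite (leq_trans (size_scale_leq _ _)) // size_polyXn; lia.
have := sum_g m.+1; have [h' szh' ->] := expr_depressed m c szh.
have -> : (e.+2 + m * e.+2 = #|F|.+1)%N by lia.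
have -> : (e + m * e.+2 = #|F|.-1)%N by lia.
(* With d >= 2 the degree, (q + 1) / d <= (q + 1) / 2, which is below q - 1 because q > 3. *)
move=> /(_ ltac:(nia)).
under eq_bigr do rewrite !hornerD hornerZ !hornerXn exprS expf_card -expr2.
rewrite !big_split /= -mulr_sumr sum_exp_card_pred sum_exp_eq0; last by lia.
rewrite sum_horner_eq0; last by apply: (leq_trans szh'); lia.
rewrite add0r addr0 mulrN1 => /eqP; rewrite oppr_eq0 mulf_eq0 (negPf c0) orbF.
(* The factor (q + 1) / d cannot vanish in F: it divides q + 1, which equals 1 there. *)
move=> /eqP m0; have : (#|F|.+1)%:R = 0 :> F by rewrite def_q natrM m0 mul0r.
by rewrite -natr1 natr_card add0r => /eqP; rewrite oner_eq0.
Qed.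

(** * Cubics and quartics as permutations *)

Lemma natr_eq0_card (F : finFieldType) (p : nat) :
  prime p -> (p%:R == 0 :> F) = (p %| #|F|)%N.
Proof.
move=> p_pr; apply/eqP/idP => [p0|p_dvd].
  by rewrite (@dvdn_pcharf F) ?natr_card // inE p_pr p0 eqxx.
have := pnatP _ (ltnW (finField_card_gt1 F)) (pnat_card_pchar F) p p_pr p_dvd.
by rewrite inE p_pr => /eqP.
Qed.

Lemma odd_card_natr2 (F : finFieldType) : odd #|F| -> 2%:R != 0 :> F.
Proof. by move=> q_odd; rewrite natr_eq0_card // dvdn2 q_odd. Qed.

Lemma cubic_injective (F : finFieldType) (c : F) :
  odd #|F| -> ~~ (3 %| #|F|)%N -> injective (fun x : F => x ^+ 3 + c * x) ->
  (#|F| = 2 %[mod 3])%N /\ c = 0.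
Proof.
move=> q_odd q_3 inj_g; have F_gt1 := finField_card_gt1 F.
have q_gt3 : (3 < #|F|)%N by lia.
have inj_h : injective (fun x : F => ('X^3 + c *: 'X^1 + 0).[x]).
  move=> x y; rewrite !addr0 !hornerD !hornerZ !hornerXn !expr1.
  exact: inj_g.
have sz0 : (size (0%R : {poly F}) <= 1)%N by rewrite size_poly0.
have no_herm := hermite_depressed (e := 1) (c := c) sz0.
have [q_1|q_2] : (3 %| #|F|.-1)%N \/ (3 %| #|F|.+1)%N by lia.
  by case: (no_herm q_gt3 (or_introl q_1) inj_h).
split; first by lia.
apply/eqP/negPn/negP => c0.
by case: (no_herm q_gt3 (or_intror (conj q_2 c0)) inj_h).
Qed.

(** Raising to the power (2 q - 1) / 3 inverts cubing, because z ^ (2 q - 1) = z. *)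
Lemma cube_injective (F : finFieldType) :
  (#|F| = 2 %[mod 3])%N -> injective (fun x : F => x ^+ 3).
Proof.
move=> q_2 x y /= xy; pose k := (#|F| %/ 3)%N.
have def_q : #|F| = (k * 3 + 2)%N by rewrite /k; lia.
have cube_root (z : F) : (z ^+ 3) ^+ (k * 2).+1 = z.
  have [->|z0] := eqVneq z 0; first by rewrite !expr0n.
  have -> : (z ^+ 3) ^+ (k * 2).+1 = z ^+ #|F| * z ^+ #|F|.-1.
    by rewrite -exprM -exprD; congr (_ ^+ _); lia.
  by rewrite expf_card expf_card_pred // mulr1.
by rewrite -(cube_root x) xy cube_root.
Qed.

(** In characteristic 3 the map is additive, so injectivity means a trivial kernel; the nonzero
    kernel elements are the nonzero roots of x ^ 2 + c. *)
Lemma char3_cubic_injective (F : finFieldType) (c : F) :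
  3%:R = 0 :> F ->
  injective (fun x : F => x ^+ 3 + c * x) <->
  (forall x, x != 0 -> x ^+ 2 + c != 0).
Proof.
move=> F3; split=> [inj_g x x0|noroot x y /= xy].
  apply: contra_neq x0 => x2c; apply: inj_g.
  by rewrite expr0n mulr0 addr0 exprSr -mulrDl x2c mul0r.
apply/eqP; rewrite -subr_eq0; apply/negPn/negP => d0.
have /eqP[] := mulf_neq0 d0 (noroot _ d0).
have -> : (x - y) * ((x - y) ^+ 2 + c) =
    (x ^+ 3 + c * x) - (y ^+ 3 + c * y) - 3%:R * (x * y * (x - y)) by ring.
by rewrite xy F3; ring.
Qed.

(** Outside characteristic 3, Hermite's criterion applies since 4 divides q - 1 or q + 1, and c !=
    0. In characteristic 3, the two zeros named above coincide only if k = 0, but then 1 and -1 have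
    the same image. *)
Lemma quartic_not_injective (F : finFieldType) (c k : F) :
  odd #|F| -> (c == 0) = (3 %| #|F|)%N ->
  ~ injective (fun x : F => x ^+ 4 + c * x ^+ 2 + k * x).
Proof.
move=> q_odd c_3 inj_g; have F2 := odd_card_natr2 q_odd.
have F_gt1 := finField_card_gt1 F.
case q_3: (3 %| #|F|)%N.
  have F3 : 3%:R = 0 :> F by apply/eqP; rewrite natr_eq0_card.
  have c0 : c = 0 by apply/eqP; rewrite c_3.
  have cube_inj : injective (fun x : F => x ^+ 3 + 0 * x).
    by apply/(char3_cubic_injective 0 F3) => x x0; rewrite addr0 expf_neq0.
  have [cbrt _ cbrtK] := injF_bij cube_inj.
  have rootk : cbrt (- k) ^+ 3 = - k by rewrite -[RHS]cbrtK mul0r addr0.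
  have k0 : k = 0.
    have : cbrt (- k) = 0.
      by apply: inj_g; rewrite c0 exprSr rootk; ring.
    by move=> r0; apply/eqP; rewrite -oppr_eq0 -rootk r0 expr0n.
  have : 1 = -1 :> F by apply: inj_g; rewrite k0; ring.
  by move/eqP; rewrite -addr_eq0 (negPf F2).
have q_gt3 : (3 < #|F|)%N by lia.
have szkX : (size (k *: 'X) <= 2)%N.
  by rewrite (leq_trans (size_scale_leq _ _)) // size_polyX.
apply: (hermite_depressed (e := 2) (c := c) szkX q_gt3) => [|x y /=].
  have [q_1|q_2] : (4 %| #|F|.-1)%N \/ (4 %| #|F|.+1)%N by lia.
    by left.
  by right; rewrite c_3 q_3.
by rewrite !hornerD !hornerZ !hornerXn !hornerX; exact: inj_g.
Qed.

(** * Injectivity of the plane map *)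

(* With eps ^ 2 = n, gamma = a + b eps, delta = tau + d eps and
   x = u + (d / 2 - y) eps, these are, up to additive constants, the two
   coordinates of f(x). *)
Definition plane_map (R : comNzRingType) (tau n a b : R) (p : R * R) : R * R :=
  let: (u, y) := p in
  (2%:R * tau * (24%:R * tau ^+ 2 * n * y ^+ 2 + 16%:R * n ^+ 2 * y ^+ 4)
     + a * u - n * b * y,
   2%:R * tau * (8%:R * tau ^+ 3 * y + 32%:R * tau * n * y ^+ 3)
     + b * u - a * y).

(* If b != 0, solving the second coordinate for u turns the first one into a
   quartic in y; translating y by h removes its cubic term, and the quadratic
   coefficient c becomes 3 times a nonzero multiple of n b ^ 2 - a ^ 2, which
   does not vanish as n is not a square. *)
Lemma plane_map_injective_real (F : finFieldType) (tau n a b : F) :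
  odd #|F| -> tau != 0 -> (forall c, n != c ^+ 2) ->
  injective (plane_map tau n a b) -> b = 0.
Proof.
move=> q_odd tau0 nNsq inj_p; apply/eqP/negPn/negP => b0.
have F2 := odd_card_natr2 q_odd.
have n0 : n != 0 by have := nNsq 0; rewrite expr0n.
pose h := a * tau / (2%:R * b * n).
pose u y := (a * y - 16%:R * tau ^+ 4 * y - 64%:R * tau ^+ 2 * n * y ^+ 3) / b.
pose c := 3%:R * (tau ^+ 2 / (2%:R * n ^+ 2 * b ^+ 2) * (n * b ^+ 2 - a ^+ 2)).
pose k := (- n * b + a * (a - 16%:R * tau ^+ 4) / b) / (32%:R * tau * n ^+ 2)
          + 3%:R * tau ^+ 2 / n * h - 8%:R * h ^+ 3.
have c_3 : (c == 0) = (3 %| #|F|)%N.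
  have nab : n * b ^+ 2 - a ^+ 2 != 0.
    rewrite subr_eq0; apply: contraNneq (nNsq (a / b)) => nab.
    by rewrite expr_div_n -nab mulfK // expf_neq0.
  rewrite /c mulf_eq0 [X in _ || X](negPf (mulf_neq0 _ nab)) ?orbF ?natr_eq0_card //.
  by rewrite mulf_neq0 ?invr_neq0 ?mulf_neq0 ?expf_neq0.
apply: (quartic_not_injective (k := k) q_odd c_3) => z1 z2 g12.
have [_] : (u (z1 + h), z1 + h) = (u (z2 + h), z2 + h); last exact: addIr.
apply: inj_p => /=; congr (_, _); last by rewrite /u; field.
have key z : 2%:R * tau * (24%:R * tau ^+ 2 * n * (z + h) ^+ 2 + 16%:R * n ^+ 2 * (z + h) ^+ 4)
     + a * u (z + h) - n * b * (z + h) = 32%:R * tau * n ^+ 2 * (z ^+ 4 + c * z ^+ 2 + k * z) +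
  (2%:R * tau * (24%:R * tau ^+ 2 * n * h ^+ 2 + 16%:R * n ^+ 2 * h ^+ 4)
     + a * u h - n * b * h).
  by rewrite /c /k /u /h; field; rewrite n0 b0 F2 tau0 (natrX _ 2 5) expf_neq0.
by rewrite !key g12.
Qed.

(** Once b = 0, the second coordinate is e (y ^ 3 + c y) and the first is affine in u with slope a
    != 0, so only the cubic matters. *)
Lemma plane_map_injective (F : finFieldType) (tau n a b : F) :
  odd #|F| -> tau != 0 -> (forall c, n != c ^+ 2) -> (a != 0) || (b != 0) ->
  injective (plane_map tau n a b) <->
  b = 0 /\ ((3 %| #|F|)%N /\ (exists c, a - (2%:R * tau) ^+ 4 = c ^+ 2)
            \/ (#|F| = 2 %[mod 3])%N /\ (2%:R * tau) ^+ 4 = a).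
Proof.
move=> q_odd tau0 nNsq ab0; have F2 := odd_card_natr2 q_odd.
have n0 : n != 0 by have := nNsq 0; rewrite expr0n.
have F_gt1 := finField_card_gt1 F.
wlog b0 : / b = 0.
  move=> wlog_b; split=> [inj_p|[b0]]; last by move=> cond; apply/wlog_b.
  have b0 := plane_map_injective_real q_odd tau0 nNsq inj_p.
  by apply/wlog_b.
have {ab0} a0 : a != 0 by move: ab0; rewrite b0 eqxx orbF.
pose e := 64%:R * tau ^+ 2 * n; pose c := (16%:R * tau ^+ 4 - a) / e.
have F64 : 64%:R != 0 :> F by rewrite (natrX _ 2 6) expf_neq0.
have e0 : e != 0 by rewrite !mulf_neq0 ?expf_neq0.
have p2E y : 2%:R * tau * (8%:R * tau ^+ 3 * y + 32%:R * tau * n * y ^+ 3) + b * 0 - a * y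
    = e * (y ^+ 3 + c * y).
  by rewrite b0 /c /e; field; rewrite F64 tau0 n0.
have inj_cubic : injective (plane_map tau n a b) <-> injective (fun y => y ^+ 3 + c * y).
  split=> inj.
    move=> y1 y2 y12.
    (* At u = - v y the first coordinate vanishes. *)
    pose v y := (2%:R * tau * (24%:R * tau ^+ 2 * n * y ^+ 2 + 16%:R * n ^+ 2 * y ^+ 4)) / a.
    have [] : (- v y1, y1) = (- v y2, y2); last by [].
    apply: inj => /=; rewrite b0; congr (_, _); first by rewrite /v; field.
    have := p2E y1; have := p2E y2; rewrite y12 b0 !mul0r !addr0 => -> ->.
    by [].
  case=> u1 y1 [u2 y2] /= [p1 p2].
  have y12 : y1 = y2.
    apply: inj; apply: (mulfI e0); rewrite -!p2E.
    by move: p2; rewrite b0 !mul0r.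
  by move: p1; rewrite y12 => /addIr/addrI/(mulfI a0) ->.
apply: (iff_trans inj_cubic).
case q_3: (3 %| #|F|)%N; last first.
  split=> [/cubic_injective|]; rewrite ?q_3.
    case=> // q_2 /eqP; rewrite mulf_eq0 invr_eq0 (negPf e0) orbF subr_eq0 => /eqP c0.
    by split=> //; right; split=> //; rewrite -c0; ring.
  case=> _ [[]//|[q_2 aE]]; have -> : c = 0 by rewrite /c -aE; ring.
  by move=> x y /=; rewrite !mul0r !addr0; exact: cube_injective.
have F3 : 3%:R = 0 :> F by apply/eqP; rewrite natr_eq0_card.
(* As n is a nonsquare, a - (2 tau) ^ 4 is a square exactly when - c is zero or a nonsquare, that
   is, when x ^ 2 + c has no nonzero root. *)
have aE : a - (2%:R * tau) ^+ 4 = - c * (8%:R * tau) ^+ 2 * n.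
  by rewrite /c /e; field; rewrite F64 tau0 n0.
have F8 : 8%:R != 0 :> F by rewrite (natrX _ 2 3) expf_neq0.
have t8 : 8%:R * tau != 0 by rewrite mulf_neq0.
apply: (iff_trans (char3_cubic_injective c F3)); split=> [noroot|].
  split=> //; left; split=> //.
  case sqP: [exists s, a - (2%:R * tau) ^+ 4 == s ^+ 2].
    by have /existsP[s /eqP] := sqP; exists s.
  have NsqP s : a - (2%:R * tau) ^+ 4 != s ^+ 2.
    by apply: contraFneq sqP => sE; apply/existsP; exists s; apply/eqP.
  have [s sE] := finField_nonsquareM NsqP nNsq.
  have cE : (s / (8%:R * tau * n)) ^+ 2 = - c.
    by rewrite expr_div_n -sE aE; field; rewrite F8 tau0 n0.
  have [x0|x0] := eqVneq (s / (8%:R * tau * n)) 0.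
    by have := NsqP 0; rewrite aE -cE x0 !expr0n /= !mul0r eqxx.
  by have := noroot _ x0; rewrite cE addNr eqxx.
case=> _ [[_ [s]]|[q_2 _]]; last by move: q_3 q_2; clear; lia.
rewrite aE => sE x x0; apply: contraNneq (nNsq (s / (8%:R * tau * x))) => x2c.
have cE : c = - x ^+ 2 by apply/eqP; rewrite -addr_eq0 addrC x2c.
rewrite expr_div_n -sE cE; apply/eqP.
by field; rewrite F8 tau0 x0.
Qed.

(** * Coordinates on the quadratic extension *)

Section QuadraticExtension.

Variables (K L : finFieldType) (iota : {rmorphism K -> L}).
Hypotheses (K_odd : odd #|K|) (card_L : #|L| = (#|K| ^ 2)%N).

Lemma exprD_card_sub (x y : L) : (x + y) ^+ #|K| = x ^+ #|K| + y ^+ #|K|.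
Proof.
apply: exprDn_pchar; apply: pnat_dvd (pnat_card_pchar L).
by rewrite card_L dvdn_exp.
Qed.

Lemma exprN_card_sub (x : L) : (- x) ^+ #|K| = - x ^+ #|K|.
Proof. by rewrite exprNn -signr_odd K_odd expr1 mulN1r. Qed.

Lemma rmorph_expf_card (c : K) : iota c ^+ #|K| = iota c.
Proof. by rewrite -rmorphXn expf_card. Qed.

(** Over K, X ^ q - X is the product of all X - c, so a root in L of its image is some [iota c]. *)
Lemma expf_card_sub_fixed (x : L) : x ^+ #|K| = x -> exists c, x = iota c.
Proof.
move=> xq; have := congr1 (fun p => (map_poly iota p).[x]) (finField_genPoly K).
rewrite rmorphB rmorph_prod /= map_polyXn map_polyX !hornerE xq subrr horner_prod.
move/esym/eqP/prodf_eq0 => [c _].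
rewrite rmorphB /= map_polyX map_polyC /= hornerXsubC subr_eq0 => /eqP ->.
by exists c.
Qed.

(** Some x in L is moved by Frobenius, as L is larger than K, and x ^ q - x is then negated. Its
    square is fixed, hence in K; a square root in K would make it fixed as well. *)
Lemma quadratic_generator :
  exists (eps : L) (n : K),
    [/\ eps != 0, eps ^+ #|K| = - eps, eps ^+ 2 = iota n & forall c, n != c ^+ 2].
Proof.
have K_gt1 := finField_card_gt1 K.
have [x xNfix] : exists x : L, x ^+ #|K| != x.
  apply/existsP; apply: contraTT K_gt1; rewrite negb_exists => /forallP fixL.
  have subK : {subset L <= codom iota}.
    move=> x _; have /negPn/eqP/expf_card_sub_fixed[c ->] := fixL x.
    exact: codom_f.
  have leK : (#|K| ^ 2 <= #|K|)%N.
    rewrite -card_L; apply: leq_trans (leq_image_card iota K).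
    exact/subset_leq_card/subsetP.
  by rewrite -leqNgt; nia.
pose eps := x ^+ #|K| - x.
have eps0 : eps != 0 by rewrite subr_eq0.
have eps_q : eps ^+ #|K| = - eps.
  rewrite exprD_card_sub exprN_card_sub -exprM mulnn -card_L expf_card.
  by rewrite opprB addrC.
have L2 : 2%:R != 0 :> L by rewrite odd_card_natr2 // card_L oddX K_odd.
have [n eps2] : exists n, eps ^+ 2 = iota n.
  by apply: expf_card_sub_fixed; rewrite exprAC eps_q sqrrN.
exists eps, n; split=> // c; apply/eqP => nc.
have eps_fixed : eps ^+ #|K| = eps.
  move/eqP: eps2; rewrite nc rmorphXn eqf_sqr => /orP[] /eqP->;
    by rewrite ?exprN_card_sub rmorph_expf_card.
move: eps_q; rewrite eps_fixed => /eqP.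
by rewrite -addr_eq0 -mulr2n -mulr_natl mulf_eq0 (negPf L2) (negPf eps0).
Qed.

Variables (eps : L) (n : K).
Hypotheses (eps0 : eps != 0) (eps_q : eps ^+ #|K| = - eps) (eps2 : eps ^+ 2 = iota n).

Definition quad_point (p : K * K) : L := iota p.1 + eps * iota p.2.

Lemma quad_point_expf_card p :
  quad_point p ^+ #|K| = iota p.1 - eps * iota p.2.
Proof. by rewrite exprD_card_sub exprMn !rmorph_expf_card eps_q mulNr. Qed.

(** A point plus its conjugate is twice its first coordinate, whence injectivity; equal
    cardinalities do the rest. *)
Lemma quad_point_bij : bijective quad_point.
Proof.
apply: inj_card_bij; last by rewrite card_prod card_L mulnn.
have L2 : 2%:R != 0 :> L by rewrite odd_card_natr2 // card_L oddX K_odd.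
move=> p p' pp'; have := congr1 (fun x => x ^+ #|K|) pp'.
rewrite /= !quad_point_expf_card => pp'q.
have e1 : p.1 = p'.1.
  apply: (fmorph_inj iota); apply: (mulfI L2); rewrite !mulr_natl !mulr2n.
  have := congr2 +%R pp' pp'q.
  by rewrite addrACA subrr [RHS]addrACA subrr !addr0.
move: pp'; rewrite /quad_point e1 => /addrI/(mulfI eps0)/fmorph_inj e2.
by rewrite [p]surjective_pairing e1 e2 -surjective_pairing.
Qed.

Lemma Tr_quad_point p : Tr_quad #|K| (quad_point p) = iota (2%:R * p.1).
Proof. by rewrite /Tr_quad quad_point_expf_card rmorphM rmorph_nat /quad_point; ring. Qed.

Lemma quad_point_codom p : (quad_point p \in codom iota) = (p.2 == 0).
Proof.
apply/codomP/eqP => [[c pc]|p0]; last first.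
  by exists p.1; rewrite /quad_point p0 rmorph0 mulr0 addr0.
have : quad_point p = quad_point (c, 0) by rewrite pc /quad_point rmorph0 mulr0 addr0.
by move/(bij_inj quad_point_bij) => ->.
Qed.

(** The shift by d / 2 turns s into tau + 2 y eps, free of d. The constant collects 2 tau ^ 5 from 2
    tau s ^ 4 and the d / 2 terms of gamma x. *)
Lemma f_poly_quad_point (tau d a b u y : K) :
  (f_poly #|K| (quad_point (a, b)) (quad_point (tau, d))).[quad_point (u, d / 2%:R - y)]
  = quad_point (plane_map tau n a b (u, y))
    + quad_point (2%:R * tau ^+ 5 + n * b * (d / 2%:R), a * (d / 2%:R)).
Proof.
have K2 := odd_card_natr2 K_odd.
rewrite /f_poly !(hornerD, hornerN, horner_exp, hornerM, hornerXn, hornerX, hornerC).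
have -> : quad_point (u, d / 2%:R - y) ^+ #|K| - quad_point (u, d / 2%:R - y)
    + quad_point (tau, d) = quad_point (tau, 2%:R * y).
  have dE : d = 2%:R * (d / 2%:R) by rewrite mulrC divfK.
  by rewrite quad_point_expf_card /quad_point /= {3}dE; ring.
rewrite exprD quad_point_expf_card /quad_point /=; move: (d / 2%:R) => d2.
rewrite !(rmorph_nat, rmorphM, rmorphXn, rmorphB, rmorphD) /= -eps2. ring.
Qed.

End QuadraticExtension.

(** * From the plane K^2 back to L *)

Theorem theorem3p5 (q : nat) (K L : finFieldType) (iota : {rmorphism K -> L})
    (gamma delta : L)
    (q_odd : odd q) (cardK : #|K| = q) (cardL : #|L| = (q ^ 2)%N)
    (gamma_neq0 : gamma != 0) :
  perm_poly_on (f_poly q gamma delta) <->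
  [\/ Tr_quad q delta = 0,
      [/\ Tr_quad q delta <> 0,
          gamma \in codom iota /\ gamma != 0,
          (3 %| q)%N
        & square_in_subfield iota
            (Tr_quad q gamma / 2%:R - Tr_quad q delta ^+ 4)]
    | [/\ Tr_quad q delta <> 0,
          gamma \in codom iota /\ gamma != 0,
          (q = 2 %[mod 3])%N
        & 2%:R * Tr_quad q delta ^+ 4 = Tr_quad q gamma]].
Proof.
subst q; have [eps [n [eps0 eps_q eps2 nNsq]]] := quadratic_generator iota q_odd cardL.
have K2 := odd_card_natr2 q_odd.
have pt_bij := quad_point_bij iota q_odd cardL eps0 eps_q.
have [pt' _ ptK] := pt_bij.
rewrite -[gamma]ptK -[delta]ptK; case: (pt' delta) => tau d; case gammaE: (pt' gamma) => [a b].
have ab0 : (a != 0) || (b != 0).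
  rewrite -negb_and; apply: contra gamma_neq0 => /andP[/eqP a0 /eqP b0].
  by rewrite -[gamma]ptK gammaE a0 b0 /quad_point !rmorph0 mulr0 addr0.
have gamma0 : quad_point iota eps (a, b) != 0 by rewrite -gammaE ptK.
rewrite !(Tr_quad_point iota cardL eps_q) (quad_point_codom iota q_odd cardL eps0 eps_q) gamma0 /=.
have perm_plane :
    perm_poly_on (f_poly #|K| (quad_point iota eps (a, b))
                              (quad_point iota eps (tau, d)))
    <-> injective (plane_map tau n a b).
  have fE := f_poly_quad_point q_odd cardL eps_q eps2 tau d a b.
  split=> [/bij_inj inj_f [u y] [u' y'] pp'|inj_p].
    have := fE u y; rewrite pp' -fE => /inj_f/(bij_inj pt_bij)[-> /addrI/oppr_inj->].
    by [].
  apply: injF_bij => x x'; rewrite -[x]ptK -[x']ptK.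
  case: (pt' x) => u v; case: (pt' x') => u' v'.
  have vE w : w = d / 2%:R - (d / 2%:R - w) by ring.
  rewrite (vE v) (vE v') !fE => /addIr/(bij_inj pt_bij)/inj_p[-> /addrI/oppr_inj->].
  by [].
have tau_eq0 : (iota (2%:R * tau) = 0) <-> tau = 0.
  split=> [/eqP|->]; last by rewrite mulr0 rmorph0.
  by rewrite fmorph_eq0 mulf_eq0 (negPf K2) => /eqP.
apply: (iff_trans perm_plane).
have [tau0|tau0] := eqVneq tau 0.
  split=> [_|_]; first by constructor 1; apply/tau_eq0.
  (* For tau = 0 the plane map is linear with determinant n b ^ 2 - a ^ 2, minus the norm of gamma;
     injectivity follows by Cramer's rule. *)
  have D0 : a ^+ 2 - n * b ^+ 2 != 0.
    have [b0|b0] := eqVneq b 0.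
      move: ab0; rewrite b0 eqxx orbF expr0n mulr0 subr0 => a0.
      by rewrite expf_neq0.
    rewrite subr_eq0; apply: contraNneq (nNsq (a / b)) => nab.
    by rewrite expr_div_n nab mulfK // expf_neq0.
  case=> u y [u' y']; rewrite /plane_map tau0 !(mulr0, mul0r, add0r) => -[p1 p2].
  congr (_, _); apply: (mulfI D0).
    transitivity (a * (a * u - n * b * y) - n * b * (b * u - a * y)); first by ring.
    by rewrite p1 p2; ring.
  transitivity (b * (a * u - n * b * y) - a * (b * u - a * y)); first by ring.
  by rewrite p1 p2; ring.
apply: (iff_trans (plane_map_injective q_odd tau0 nNsq ab0)).
have Ntau : iota (2%:R * tau) <> 0 by move/tau_eq0/eqP; rewrite (negPf tau0).
(* Since Tr gamma = 2 a and Tr delta = 2 tau, both conditions descend to K along the injective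
   [iota]. *)
have sqE s :
    (iota (2%:R * a) / 2%:R - iota (2%:R * tau) ^+ 4 = iota (s ^+ 2))
    <-> a - (2%:R * tau) ^+ 4 = s ^+ 2.
  have -> : iota (2%:R * a) / 2%:R - iota (2%:R * tau) ^+ 4 = iota (a - (2%:R * tau) ^+ 4).
    by rewrite -(rmorph_nat iota 2) -rmorphXn -fmorph_div -rmorphB mulrAC mulfV ?mul1r.
  by split=> [/fmorph_inj|->].
have eqE : (2%:R * iota (2%:R * tau) ^+ 4 = iota (2%:R * a)) <-> (2%:R * tau) ^+ 4 = a.
  by rewrite -rmorphXn -(rmorph_nat iota 2) -rmorphM; split=> [/fmorph_inj/(mulfI K2)|->].
split.
  case=> -> [[q3 [s /sqE sE]]|[q2 /eqE tE]].
    by constructor 2; rewrite eqxx; split=> //; exists s.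
  by constructor 3; rewrite eqxx.
case=> [//|[_ [/eqP -> _] q3 [s /sqE sE]]|[_ [/eqP -> _] q2 /eqE tE]]; split=> //; [left|right].
  by split=> //; exists s.
by [].
Qed.
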